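(* Let $x,y,u,v,p_+,p_-,q_+,q_-$ be indeterminates, and for $n\ge0$ define $$\begin{aligned}P_n(x,y,u,v,p_+,p_-,q_+,q_-)=\sum_{\sigma\in\mathfrak S_n}\;&x^{\mathrm{arec}(\sigma)}y^{\mathrm{erec}(\sigma)}u^{\,n-\mathrm{exc}(\sigma)-\mathrm{arec}(\sigma)}v^{\,\mathrm{exc}(\sigma)-\mathrm{erec}(\sigma)}\\&\times p_+^{\mathrm{ucross}(\sigma)}p_-^{\mathrm{lcross}(\sigma)+\mathrm{ljoin}(\sigma)}q_+^{\mathrm{unest}(\sigma)}q_-^{\mathrm{lnest}(\sigma)+\mathrm{psnest}(\sigma)}.\end{aligned}$$ Then $$\sum_{n=0}^\infty P_n(x,y,u,v,p_+,p_-,q_+,q_-)\,t^n=\cfrac{1}{1-\cfrac{\alpha_1t}{1-\cfrac{\alpha_2t}{1-\cfrac{\alpha_3 t}{1-\cdots}}}}$$ with coefficients, for $k\ge1$, $$\alpha_{2k-1}=p_-^{k-1}x+q_-[k-1]_{p_-,q_-}u,\qquad \alpha_{2k}=p_+^{k-1}y+q_+[k-1]_{p_+,q_+}v.$$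
   Context: $[n]_{p,q}=\sum_{j=0}^{n-1}p^jq^{n-1-j}$ (so $[0]_{p,q}=0$). $\mathfrak S_n$ is the set of permutations of $[n]=\{1,\dots,n\}$. Continued fractions are identities of formal power series in $t$. For $\sigma\in\mathfrak S_n$, an index $i$ is a record if $\sigma(j)<\sigma(i)$ for all $j<i$; an antirecord if $\sigma(j)>\sigma(i)$ for all $j>i$; an exclusive record if it is a record and not an antirecord; an excedance if $\sigma(i)>i$. $\mathrm{arec},\mathrm{erec},\mathrm{exc}$ count antirecords, exclusive records and excedances. (All exponents appearing are nonnegative.) $\mathrm{ucross}(\sigma)$, $\mathrm{lcross}(\sigma)$, $\mathrm{unest}(\sigma)$, $\mathrm{lnest}(\sigma)$ are the numbers of quadruplets $i<j<k<l$ in $[n]$ such that, respectively: ($k=\sigma(i)$ and $l=\sigma(j)$); ($i=\sigma(k)$ and $j=\sigma(l)$); ($l=\sigma(i)$ and $k=\sigma(j)$); ($i=\sigma(l)$ and $j=\sigma(k)$). $\mathrm{ljoin}(\sigma)$ is the number of triplets $i<j<l$ with $i=\sigma(j)$ and $j=\sigma(l)$. $\mathrm{psnest}(\sigma)$ is the number of triplets $i<j<l$ with $\sigma(j)=j$ and $l=\sigma(i)$ (equivalently, with $\sigma(j)=j$ and $i=\sigma(l)$). *)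

(* Defs.v *)
From mathcomp Require Import all_boot all_fingroup all_algebra.

Set Implicit Arguments.
Unset Strict Implicit.
Unset Printing Implicit Defensive.

Import GRing.Theory.

(* Permutations of {1, ..., n} are represented by 'S_n, the permutations of
   'I_n = {0, ..., n-1}; every statistic below only compares indices and values,
   so the shift by one is harmless. *)
Section Statistics.

Variables (n : nat) (s : 'S_n).

Definition is_record (i : 'I_n) : bool := [forall j : 'I_n, (j < i) ==> (s j < s i)].

Definition is_antirecord (i : 'I_n) : bool :=
  [forall j : 'I_n, (i < j) ==> (s i < s j)].

Definition arec : nat := #|[set i | is_antirecord i]|.

Definition erec : nat := #|[set i | is_record i && ~~ is_antirecord i]|.

Definition exc : nat := #|[set i : 'I_n | i < s i]|.

Definition ucross : nat :=
  #|[set q : 'I_n * 'I_n * 'I_n * 'I_n |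
     let: (i, j, k, l) := q in [&& i < j, j < k, k < l, k == s i & l == s j]]|.

Definition lcross : nat :=
  #|[set q : 'I_n * 'I_n * 'I_n * 'I_n |
     let: (i, j, k, l) := q in [&& i < j, j < k, k < l, i == s k & j == s l]]|.

Definition unest : nat :=
  #|[set q : 'I_n * 'I_n * 'I_n * 'I_n |
     let: (i, j, k, l) := q in [&& i < j, j < k, k < l, l == s i & k == s j]]|.

Definition lnest : nat :=
  #|[set q : 'I_n * 'I_n * 'I_n * 'I_n |
     let: (i, j, k, l) := q in [&& i < j, j < k, k < l, i == s l & j == s k]]|.

Definition ljoin : nat :=
  #|[set q : 'I_n * 'I_n * 'I_n |
     let: (i, j, l) := q in [&& i < j, j < l, i == s j & j == s l]]|.

Definition psnest : nat :=
  #|[set q : 'I_n * 'I_n * 'I_n |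
     let: (i, j, l) := q in [&& i < j, j < l, s j == j & l == s i]]|.

(* Truncated subtraction loses nothing in the exponents of [Ppoly]. *)
Lemma exc_arec_le : exc + arec <= n.
Proof.
rewrite -cardsUI -[leqRHS]card_ord [X in _ + X](_ : _ = 0) ?addn0 ?max_card //.
apply/eqP; rewrite cards_eq0 -subset0; apply/subsetP=> i.
rewrite !inE => /andP[lt_i_si /forallP anti_i]; exfalso.
pose A := [set s j | j in [set j : 'I_n | i <= j]].
have: A \subset [set j : 'I_n | i < j].
  apply/subsetP=> _ /imsetP[j lij ->]; move: lij; rewrite !inE leq_eqVlt.
  case/orP=> [/eqP/val_inj <- //|lt_ij].
  by apply: ltn_trans lt_i_si _; have := anti_i j; rewrite lt_ij.
move/subset_leq_card; rewrite card_imset; last exact: perm_inj.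
rewrite leqNgt => /negP; apply; apply: proper_card; apply/properP; split.
  by apply/subsetP=> j; rewrite !inE => /ltnW.
by exists i; rewrite !inE ?ltnn.
Qed.

Lemma erec_le_exc : erec <= exc.
Proof.
apply/subset_leq_card/subsetP=> i; rewrite !inE => /andP[/forallP rec_i].
rewrite negb_forall => /existsP[k]; rewrite negb_imply -leqNgt.
case/andP=> lt_ik le_sk; rewrite ltnNge; apply/negP=> le_si_i.
have lt_sk : s k < s i.
  rewrite ltn_neqAle le_sk andbT; apply/eqP=> /val_inj/perm_inj eq_ki.
  by rewrite eq_ki ltnn in lt_ik.
pose B := k |: [set j : 'I_n | j < i].
have: [set s j | j in B] \subset [set j : 'I_n | j < s i].
  apply/subsetP=> _ /imsetP[j lij ->]; move: lij; rewrite !inE.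
  case/orP=> [/eqP -> //|lt_ji].
  by have := rec_i j; rewrite lt_ji.
move/subset_leq_card; rewrite card_imset; last exact: perm_inj.
rewrite leqNgt => /negP; apply; rewrite cardsU1 inE -leqNgt (ltnW lt_ik) add1n ltnS.
by apply/subset_leq_card/subsetP=> j; rewrite !inE => /leq_trans; apply.
Qed.

End Statistics.

Local Open Scope ring_scope.

Definition pq_int (R : comNzRingType) (p q : R) (n : nat) : R :=
  \sum_(j < n) p ^+ j * q ^+ (n - 1 - j).

Definition Ppoly (R : comNzRingType) (x y u v pp pm qp qm : R) (n : nat) : R :=
  \sum_(s : 'S_n)
    x ^+ arec s * y ^+ erec s
    * u ^+ (n - exc s - arec s) * v ^+ (exc s - erec s)
    * pp ^+ ucross s * pm ^+ (lcross s + ljoin s)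
    * qp ^+ unest s * qm ^+ (lnest s + psnest s).

(* The power series sum_n (f n) t^n is represented by its coefficient
   sequence f. *)
Section PowerSeries.

Variable R : comNzRingType.

Definition fps := nat -> R.

Definition fps_one : fps := fun n => (n == 0%N)%:R.

Definition fps_sub (f g : fps) : fps := fun n => f n - g n.

Definition fps_mul (f g : fps) : fps := fun n => \sum_(i < n.+1) f i * g (n - i)%N.

Definition fps_exp (f : fps) (k : nat) : fps := iter k (fps_mul f) fps_one.

(* The series a * t * f. *)
Definition fps_scale_shift (a : R) (f : fps) : fps :=
  fun n => if n is m.+1 then a * f m else 0.

(* 1 / (1 - h) for a series h without constant term, as the geometric series
   sum_k h^k: only the terms with k <= n contribute to the coefficient of t^n.
   See [fps_mul_inv1B]. *)
Definition fps_inv1B (h : fps) : fps := fun n => \sum_(k < n.+1) fps_exp h k n.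

(* The truncation 1/(1 - a_k t/(1 - a_(k+1) t/(... /(1 - a_(k+m-1) t)))). *)
Fixpoint sfrac_trunc (a : nat -> R) (k m : nat) : fps :=
  if m is m'.+1 then
    fps_inv1B (fps_scale_shift (a k) (sfrac_trunc a k.+1 m'))
  else fps_one.

(* Convergence in the t-adic topology: every coefficient is eventually
   constant. *)
Definition fps_cvg (F : nat -> fps) (f : fps) : Prop :=
  forall n, exists N, forall m, (N <= m)%N -> F m n = f n.

(* f = 1/(1 - a_1 t/(1 - a_2 t/(1 - ...))). *)
Definition is_sfrac (a : nat -> R) (f : fps) : Prop :=
  fps_cvg (sfrac_trunc a 1%N) f.

Lemma fps_exp_small (h : fps) k n : h 0%N = 0 -> (n < k)%N -> fps_exp h k n = 0.
Proof.
move=> h0; elim: k n => // k IHk n lt_nk.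
rewrite /fps_exp iterS -/(fps_exp h k) /fps_mul big1 // => -[[|i] /= lt_in] _.
  by rewrite h0 mul0r.
rewrite IHk ?mulr0 // ltn_subLR //.
by rewrite addSn ltnS; apply: leq_trans (leq_addl _ _); rewrite -ltnS.
Qed.

Lemma fps_mul_inv1B (h : fps) : h 0%N = 0 ->
  fps_mul (fps_sub fps_one h) (fps_inv1B h) =1 fps_one.
Proof.
move=> h0 n.
have invE m : (m <= n)%N -> fps_inv1B h m = \sum_(k < n.+1) fps_exp h k m.
  move=> le_mn; rewrite /fps_inv1B (big_ord_widen n.+1 (fun k => fps_exp h k m)) //.
  rewrite big_mkcond /=; apply: eq_bigr => k _; case: ltnP => // lt_mk.
  by rewrite fps_exp_small.
rewrite /fps_mul /fps_sub (eq_bigr (fun i : 'I_n.+1 =>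
    fps_one i * fps_inv1B h (n - i)%N - h i * fps_inv1B h (n - i)%N)); last first.
  by move=> i _; rewrite mulrBl.
rewrite sumrB big_ord_recl /= mul1r subn0 big1 ?addr0; last first.
  by move=> i _; rewrite /fps_one mul0r.
have -> : \sum_(i < n.+1) h i * fps_inv1B h (n - i)%N
        = \sum_(k < n.+1) fps_exp h k.+1 n.
  under eq_bigr => i _ do rewrite invE ?leq_subr // mulr_sumr.
  by rewrite exchange_big.
have -> : \sum_(k < n.+1) fps_exp h k.+1 n = \sum_(k < n) fps_exp h k.+1 n.
  by rewrite big_ord_recr (fps_exp_small h0 (ltnSn _)) [LHS]addr0.
by rewrite /fps_inv1B big_ord_recl [LHS]addrK.
Qed.

End PowerSeries.

(* Main.v *)
Require Import Defs.
From mathcomp Require Import all_boot all_fingroup all_algebra.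
From mathcomp Require Import zify.

Set Implicit Arguments.
Unset Strict Implicit.
Unset Printing Implicit Defensive.

Import GRing.Theory.
Local Open Scope ring_scope.

(** The proof is Foata and Zeilberger's bijection in matching form. List the
    values and positions as 2n points: value 0, position 0, value 1, position 1,
    and so on. A permutation joins each position to its value, which gives a
    perfect matching whose arcs join points of opposite parities, and every such
    matching arises.

    Scan the points from left to right. A point that opens an arc is a rise of a
    Dyck path, one that closes an arc is a fall, and the height is the number of
    pending arcs. A closing point chooses its partner among the pending points of
    the other parity. If c of them are pending and r lie to the left of the
    chosen one, the new arc is nested in r pending arcs and crosses c - 1 - r of
    them. When the closing point is a value, the arc is an excedance, these
    numbers are its contributions to unest and ucross, and r = 0 means that it is
    a record. When it is a position, they are its contributions to
    lnest + psnest and to lcross + ljoin, and r = 0 means that it is an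
    antirecord. The weight of the permutation is thus a product over the closing
    points ([item_wt_val], [item_wt_pos] and the lemmas on each statistic).

    Summing the weight of a closing point over r gives p^(c-1) x + q [c-1] u, or
    its analogue with y and v ([sum_arc_wt]). The height before the fall is 2c at
    a value and 2c - 1 at a position, so this sum is the coefficient alpha whose
    index is the height. It does not depend on which points are pending, so the
    choices can be summed one after the other, and P_n is the total weight of the
    Dyck paths of length 2n ([sum_perfect]). This weight is the coefficient of
    t^n in the continued fraction ([is_sfrac_dyck]). *)

(** * Stieltjes continued fractions and weighted Dyck paths *)
Section ContinuedFraction.

Variables (R : comNzRingType) (a : nat -> R).

(** Coefficients of index below N depend only on truncations at degree N, so
    associativity and commutativity of the product can be borrowed from
    polynomials. *)
Lemma fps_mul_poly (f g : fps R) N n : (n < N)%N ->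
  fps_mul f g n = ((\poly_(i < N) f i) * (\poly_(i < N) g i))`_n.
Proof.
move=> lt_nN; rewrite coefM; apply: eq_bigr => i _; rewrite !coef_poly.
by rewrite (leq_ltn_trans (leq_subr _ _) lt_nN) (leq_trans (ltn_ord i)).
Qed.

Lemma fps_mulA (f g h : fps R) : fps_mul f (fps_mul g h) =1 fps_mul (fps_mul f g) h.
Proof.
move=> n; pose p (k : fps R) := \poly_(i < n.+1) k i.
have pM k l i : (i < n.+1)%N -> (p (fps_mul k l))`_i = (p k * p l)`_i.
  by move=> lt_in; rewrite coef_poly lt_in (@fps_mul_poly _ _ n.+1).
rewrite !(@fps_mul_poly _ _ n.+1) // -!/(p _).
transitivity ((p f * (p g * p h))`_n).
  by rewrite !coefM; apply: eq_bigr => i _; rewrite pM // ltnS leq_subr.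
by rewrite mulrA !coefM; apply: eq_bigr => i _; rewrite pM.
Qed.

Lemma fps_mulC (f g : fps R) : fps_mul f g =1 fps_mul g f.
Proof. by move=> n; rewrite !(@fps_mul_poly _ _ n.+1) // mulrC. Qed.

Lemma sfrac_trunc_coef0 k d : sfrac_trunc a k d 0%N = 1.
Proof.
by case: d => [|d] //; rewrite /= /fps_inv1B big_ord1 /fps_exp /=.
Qed.

(** The functional equation f = 1 + a_k t f f', where f' is the fraction that
    starts one level further. *)
Lemma sfrac_trunc_coefS k d n : sfrac_trunc a k d.+1 n.+1
  = a k * fps_mul (sfrac_trunc a k d.+1) (sfrac_trunc a k.+1 d) n.
Proof.
pose h := fps_scale_shift (a k) (sfrac_trunc a k.+1 d).
have := @fps_mul_inv1B _ h (erefl _) n.+1.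
rewrite -/(sfrac_trunc a k d.+1) fps_mulC -fps_mulC /fps_mul big_ord_recl.
rewrite /fps_sub /= {1}/fps_one /= subr0 mul1r /fps_one /= => /eqP.
rewrite addr_eq0 => /eqP; rewrite subn0 => ->.
rewrite -[in RHS]/(fps_mul _ _ n) fps_mulC /fps_mul mulr_sumr -sumrN.
by apply: eq_bigr => i _; rewrite sub0r mulNr opprK /= mulrA.
Qed.

(** Total weight of the paths with m unit steps that go from height h to 0 and
    stay nonnegative, a fall from height h weighing [a h] and a rise 1. *)
Fixpoint dyck (m h : nat) : R :=
  if m is m'.+1 then
    dyck m' h.+1 + (if h is h'.+1 then a h * dyck m' h' else 0)
  else (h == 0%N)%:R.

(** The series a_1 ... a_h f_1 ... f_(h+1), with f_k the fraction that runs from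
    level k to level d. Cutting a path from height h to 0 at its first visits to
    the heights h-1, ..., 0 shows that, up to truncation, this is the generating
    function of such paths, t marking the rises. *)
Fixpoint sfrac_prod (d h : nat) : fps R :=
  if h is h'.+1 then
    fun n => a h * fps_mul (sfrac_prod d h') (sfrac_trunc a h.+1 (d - h)) n
  else sfrac_trunc a 1 d.

Lemma sfrac_prodS0 d h : sfrac_prod d h.+1 0%N = a h.+1 * sfrac_prod d h 0%N.
Proof.
by rewrite /= /fps_mul big_ord1 subn0 sfrac_trunc_coef0 mulr1.
Qed.

Lemma sfrac_prod0S d n : (0 < d)%N -> sfrac_prod d 0 n.+1 = sfrac_prod d 1 n.
Proof. by case: d => // d _; rewrite [LHS]sfrac_trunc_coefS /= subn1. Qed.

(** Splitting the last factor by its functional equation separates the paths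
    that start with a fall from those that start with a rise. *)
Lemma sfrac_prodSS d h n : (h.+1 < d)%N ->
  sfrac_prod d h.+1 n.+1 = a h.+1 * sfrac_prod d h n.+1 + sfrac_prod d h.+2 n.
Proof.
move=> lt_hd; set g := sfrac_prod d h.
have -> : sfrac_prod d h.+1 n.+1
    = a h.+1 * fps_mul g (sfrac_trunc a h.+2 (d - h.+1)) n.+1 by [].
have -> : sfrac_prod d h.+2 n = a h.+2 * fps_mul (fun n => a h.+1 *
    fps_mul g (sfrac_trunc a h.+2 (d - h.+1)) n) (sfrac_trunc a h.+3 (d - h.+2)) n.
  by [].
have -> : (d - h.+1 = (d - h.+2).+1)%N by lia.
set f := sfrac_trunc _ h.+2 _; set f' := sfrac_trunc _ h.+3 _.
have -> : fps_mul (fun n => a h.+1 * fps_mul g f n) f' n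
    = a h.+1 * fps_mul g (fps_mul f f') n.
  by rewrite fps_mulA /fps_mul mulr_sumr; apply: eq_bigr => i _; rewrite mulrA.
rewrite mulrCA -mulrDr; congr (_ * _).
rewrite {1}/fps_mul big_ord_recr /= subnn /f sfrac_trunc_coef0 mulr1 addrC.
congr (_ + _); rewrite /fps_mul mulr_sumr; apply: eq_bigr => i _.
have -> : (n.+1 - i = (n - i).+1)%N by case: i => i /=; lia.
by rewrite sfrac_trunc_coefS mulrCA.
Qed.

(** Both sides satisfy the same recurrence. The sum h + n never increases along
    it, so a fraction of depth at least h + n is never exhausted. *)
Lemma dyck_sfrac_prod d n h : (h + n <= d)%N ->
  dyck (n.*2 + h) h = sfrac_prod d h n.
Proof.
move Dm: (n.*2 + h)%N => m; elim: m n h Dm => [|m IHm] n h Dm le_d.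
  have [-> ->] : n = 0%N /\ h = 0%N by lia.
  by rewrite /= sfrac_trunc_coef0.
case: h n => [|h] [|n] in Dm le_d *; rewrite [LHS]/=.
- by lia.
- by rewrite addr0 sfrac_prod0S -?IHm //; lia.
- have dyck0 m' h' : (m' < h')%N -> dyck m' h' = 0.
    elim: m' h' => [|m' IH] [|h'] //= lt_mh.
    by rewrite !IH ?mulr0 ?addr0 //; lia.
  by rewrite dyck0 ?add0r ?sfrac_prodS0 -?(IHm 0%N) //; lia.
- rewrite sfrac_prodSS; last by lia.
  by rewrite -(IHm n.+1 h) -?(IHm n h.+2) 1?addrC //; lia.
Qed.

Lemma is_sfrac_dyck (f : fps R) : (forall n, f n = dyck n.*2 0) -> is_sfrac a f.
Proof.
move=> fE n; exists n => d le_nd; rewrite fE.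
by rewrite -[n.*2]addn0 (@dyck_sfrac_prod d).
Qed.

End ContinuedFraction.

(** * Perfect matchings scanned from left to right *)

(** The rank map from O to {0, ..., #|O| - 1} is a bijection; the proof removes
    the largest element of O repeatedly. *)
Lemma sum_rank (R : nmodType) (N : nat) (O : {set 'I_N}) (F : nat -> nat -> R) :
  \sum_(a in O) F #|[set i in O | (i < a)%N]| #|[set i in O | (a < i)%N]|
  = \sum_(r < #|O|) F r (#|O| - 1 - r)%N.
Proof.
move Dc: #|O| => c; elim: c O F Dc => [|c IHc] O F Dc.
  by rewrite big_ord0 big_pred0 // => a; rewrite (cards0_eq Dc) inE.
have [z0 z0O] : exists z, z \in O by apply/card_gt0P; rewrite Dc.
case: (arg_maxnP (fun i : 'I_N => i : nat) z0O) => z zmemO zmax.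
have {zmemO} zO : z \in O by [].
have Dc' : #|O :\ z| = c by move: Dc; rewrite (cardsD1 z) zO add1n => -[].
rewrite (big_setD1 z zO) /= big_ord_recr /= addrC; congr (_ + _).
  transitivity (\sum_(i in O :\ z)
      F #|[set j in O :\ z | (j < i)%N]| #|[set j in O :\ z | (i < j)%N]|.+1).
    apply: eq_bigr => i; rewrite !inE => /andP[i_neq_z iO].
    have lt_iz : (i < z)%N.
      by rewrite ltn_neqAle i_neq_z; apply: zmax.
    congr (F _ _).
      apply: eq_card => j; rewrite !inE; case: eqP => // ->.
      by rewrite ltnNge (ltnW lt_iz) andbF.
    rewrite (cardsD1 z) !inE zO lt_iz add1n; congr _.+1.
    by apply: eq_card => j; rewrite !inE andbA.
  rewrite (IHc _ (fun r s => F r s.+1)) //; apply: eq_bigr => i _.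
  by congr (F _ _); case: i => i /=; lia.
congr (F _ _).
  rewrite -Dc'; apply: eq_card => i; rewrite !inE andbC; case iO: (i \in O).
    by rewrite !andbT ltn_neqAle; apply: andb_idr => _; apply: zmax.
  by rewrite !andbF.
apply/eqP; rewrite subn1 subnn cards_eq0 -subset0; apply/subsetP=> i.
by rewrite !inE => /andP[/zmax/= le_iz]; rewrite ltnNge le_iz.
Qed.

Section Matchings.

Variable N : nat.
Implicit Types (f m : {ffun 'I_N -> 'I_N}) (i j : 'I_N) (k : nat).

(** A matching is encoded by the involution that exchanges the two ends of each
    arc. Arcs join points of opposite parities. *)
Definition perfect m :=
  [forall i, (m (m i) == i) && (odd (m i) != odd i)].

(** A matching with all its arcs below k: unmatched points are the fixed points
    of the involution. *)
Definition partial k f :=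
  [forall i, [&& f (f i) == i, (f i != i) ==> (odd (f i) != odd i)
               & (k <= i)%N ==> (f i == i)]].

(** The arcs of m with both ends below k; a point whose partner is at least k
    becomes a fixed point. *)
Definition prefix k m : {ffun 'I_N -> 'I_N} :=
  [ffun i : 'I_N => if (i < k)%N && (m i < k)%N then m i else i].

Definition add_arc f j z : {ffun 'I_N -> 'I_N} :=
  [ffun i => if i == j then z else if i == z then j else f i].

Definition opens k b f := [set i : 'I_N | [&& i < k, f i == i & odd i == b]]%N.

(** The points that k can be joined to when it closes an arc. *)
Definition avail m k : {set 'I_N} := opens k (~~ odd k) (prefix k m).

Lemma perfect_neq m i : perfect m -> m i != i.
Proof. by move=> /forallP/(_ i)/andP[_]; apply: contraNneq => ->. Qed.

Lemma prefix_open m k i : perfect m -> (i < k)%N ->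
  (prefix k m i == i) = (k <= m i)%N.
Proof.
move=> pm lt_ik; rewrite ffunE lt_ik /= [RHS]leqNgt.
by case: ifP => _; rewrite ?eqxx ?(negPf (perfect_neq _ pm)).
Qed.

Section Step.

Variables (k : 'I_N) (f : {ffun 'I_N -> 'I_N}).
Hypothesis pf : partial k f.

Let f_id i : (k <= i)%N -> f i = i.
Proof. by move/forallP/(_ i)/and3P: pf => [_ _ /implyP H] /H/eqP. Qed.

Let fK i : f (f i) = i.
Proof. by move/forallP/(_ i)/and3P: pf => [/eqP]. Qed.

(** When k is scanned, it either stays unmatched, because its partner comes
    later, or is joined to an available point, as in [prefixS_arc]. *)
Lemma prefixS_open m : perfect m ->
  (prefix k.+1 m == f) = (prefix k m == f) && (k < m k)%N.
Proof.
move=> pm; apply/eqP/andP=> [pfE|[/eqP pfE lt_kmk]].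
  have lt_kmk : (k < m k)%N.
    have := f_id (leqnn k); rewrite -pfE ffunE ltnSn /= ltnS.
    by case: leqP => // _ /eqP; rewrite (negPf (perfect_neq _ pm)).
  split=> //; apply/eqP/ffunP=> i; rewrite -pfE !ffunE !ltnS.
  case: (ltngtP i k) => //= [lt_ik|/val_inj eq_ik]; last by rewrite eq_ik leqNgt lt_kmk.
  case: (ltngtP (m i) k) => //= /val_inj mik.
  have /forallP/(_ i)/andP[/eqP mmi _] := pm.
  by move: lt_kmk; rewrite -mik mmi mik ltnNge (ltnW lt_ik).
apply/ffunP=> i; rewrite -pfE !ffunE !ltnS.
case: (ltngtP i k) => //= [lt_ik|/val_inj eq_ik]; last by rewrite eq_ik leqNgt lt_kmk.
case: (ltngtP (m i) k) => //= /val_inj mik.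
have /forallP/(_ i)/andP[/eqP mmi _] := pm.
by move: lt_kmk; rewrite -mik mmi mik ltnNge (ltnW lt_ik).
Qed.

Lemma prefixS_arc m z : perfect m -> z \in opens k (~~ odd k) f ->
  (prefix k.+1 m == add_arc f k z) = (prefix k m == f) && (m k == z).
Proof.
move=> pm; rewrite inE => /and3P[lt_zk /eqP fz _].
have mK i : m (m i) = i by have /forallP/(_ i)/andP[/eqP] := pm.
apply/eqP/andP=> [pfE|[/eqP pfE /eqP mk]].
  have mk : m k = z.
    have := congr1 (fun g : {ffun 'I_N -> 'I_N} => g k) pfE; rewrite !ffunE eqxx ltnSn /=.
    by case: ifP => // _ kz; move: lt_zk; rewrite -kz ltnn.
  split; last by rewrite mk.
  apply/eqP/ffunP=> i; have := congr1 (fun g : {ffun 'I_N -> 'I_N} => g i) pfE.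
  rewrite !ffunE; case: eqP => [->|neq_ik]; first by rewrite ltnn f_id.
  case: eqP => [->|neq_iz].
    by rewrite lt_zk -mk mK ltnn /= mk fz.
  have -> : (i < k.+1)%N = (i < k)%N.
    by rewrite ltnS leq_eqVlt; case: eqP => // /val_inj.
  have -> // : (m i < k.+1)%N = (m i < k)%N.
  rewrite ltnS leq_eqVlt; case: eqP => // /val_inj mik.
  by case: neq_iz; rewrite -mk -mik mK.
apply/ffunP=> i; rewrite !ffunE.
case: eqP => [->|neq_ik]; first by rewrite ltnSn mk ltnS (ltnW lt_zk).
case: eqP => [->|neq_iz]; first by rewrite -mk mK ltnSn mk ltnS (ltnW lt_zk).
rewrite -pfE ffunE.
have -> : (i < k.+1)%N = (i < k)%N.
  by rewrite ltnS leq_eqVlt; case: eqP => // /val_inj.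
have -> // : (m i < k.+1)%N = (m i < k)%N.
rewrite ltnS leq_eqVlt; case: eqP => // /val_inj mik.
by case: neq_iz; rewrite -mk -mik mK.
Qed.

Lemma partialS_open : partial k.+1 f.
Proof.
apply/forallP=> i; move/forallP/(_ i)/and3P: pf => [-> -> /implyP H] /=.
by apply/implyP=> /ltnW.
Qed.

Lemma partialS_arc z : z \in opens k (~~ odd k) f -> partial k.+1 (add_arc f k z).
Proof.
rewrite inE => /and3P[lt_zk /eqP fz odd_z].
have neq_zk : z != k by apply: contraTneq lt_zk => ->; rewrite ltnn.
have fk : f k = k by apply: f_id.
apply/forallP=> i; rewrite !ffunE; case: (eqVneq i k) => [->|neq_ik].
  by rewrite eqxx (negPf neq_zk) (eqP odd_z) eqxx ltnn; case: (odd k).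
case: (eqVneq i z) => [->|neq_iz].
  rewrite !eqxx (eqP odd_z) ltnNge ltnW //= andbT.
  by apply/implyP=> _; case: (odd k).
have -> : (f i == k) = false.
  by apply: contra_neqF neq_ik => /eqP fik; rewrite -[i]fK fik fk.
have -> : (f i == z) = false.
  by apply: contra_neqF neq_iz => /eqP fik; rewrite -[i]fK fik fz.
by have /forallP/(_ i)/and3P[-> -> /implyP H] := partialS_open; apply/implyP.
Qed.

Lemma opensS_open b : opens k.+1 b f
  = if odd k == b then k |: opens k b f else opens k b f.
Proof.
apply/setP=> i; rewrite (fun_if (fun A : {set 'I_N} => i \in A)) !inE ltnS.
have [->|neq_ik] := eqVneq i k.
  by rewrite leqnn ltnn f_id //= eqxx; case: eqP.
have -> : (i <= k)%N = (i < k)%N.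
  by rewrite [RHS]ltn_neqAle neq_ik.
by case: ifP.
Qed.

Lemma opensS_arc z b : z \in opens k (~~ odd k) f ->
  opens k.+1 b (add_arc f k z) = opens k b f :\ z.
Proof.
rewrite inE => /and3P[lt_zk /eqP fz odd_z].
have neq_zk : z != k by apply: contraTneq lt_zk => ->; rewrite ltnn.
apply/setP=> i; rewrite !inE !ffunE ltnS.
have [->|neq_ik] := eqVneq i k; first by rewrite (negPf neq_zk) /= ltnn !andbF.
have -> : (i <= k)%N = (i < k)%N.
  by rewrite [RHS]ltn_neqAle neq_ik.
have [->|//] := eqVneq i z.
by rewrite eq_sym (negPf neq_zk) andbF.
Qed.

End Step.

Variables (R : comNzRingType) (W : bool -> nat -> nat -> R).

(** Only closers have a weight. It depends on the position of the partner among
    the available points: those to its left close later and give arcs that nest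
    over the new one, those to its right give arcs that cross it. *)
Definition item_wt m i : R :=
  if (i < m i)%N then 1 else
  W (odd i) #|[set j in avail m i | (j < m i)%N]| #|[set j in avail m i | (m i < j)%N]|.

Variable a : nat -> R.
(* At height h the available points number c, with h = 2c if k is even and
   h = 2c - 1 if k is odd, so that the hypothesis says that the weights of the
   possible partners sum to the weight of a fall from h. *)
Hypothesis W_sum : forall b c, (0 < c)%N ->
  \sum_(r < c) W b r (c - 1 - r) = a (c.*2 - b)%N.

(** The weight that remains to be collected depends only on the number of
    unmatched points. The balance hypothesis relates the numbers of even and odd
    unmatched points: among the first k points the even ones exceed the odd ones
    by [odd k], and an arc uses one of each. The induction goes down from
    k = N, where at most one matching has a given prefix. *)
Lemma sum_perfect_prefix k f : (k <= N)%N -> partial k f ->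
  #|opens k false f| = (#|opens k true f| + odd k)%N ->
  \sum_(m | perfect m && (prefix k m == f)) \prod_(i : 'I_N | (k <= i)%N) item_wt m i
  = dyck a (N - k) (#|opens k false f| + #|opens k true f|).
Proof.
move Dd: (N - k)%N => d; elim: d k f Dd => [|d IHd] k f Dd le_kN pf bal.
  have {Dd le_kN} Dk : k = N by lia.
  have prefixN m : prefix k m = m by apply/ffunP=> i; rewrite ffunE Dk !ltn_ord.
  under eq_bigl => m do rewrite prefixN.
  under eq_bigr => m _.
    rewrite big_pred0; last by move=> i; rewrite Dk leqNgt ltn_ord.
    over.
  rewrite /= addn_eq0 !cards_eq0.
  have [pmf|npmf] := boolP (perfect f).
    rewrite (eq_bigl (pred1 f)); last first.
      by move=> m /=; apply: andb_idl => /eqP ->.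
    have opens0 b : opens k b f == set0.
      apply/eqP/setP=> i; rewrite !inE (negPf (perfect_neq _ pmf)).
      by rewrite andbF.
    by rewrite big_pred1_eq !opens0.
  rewrite big_pred0 => [|m]; last by apply: contraNF npmf => /andP[pm /eqP <-].
  apply/esym/eqP; rewrite -[0]/(false%:R).
  case: (opens k false f =P set0) => [e0|//].
  case: (opens k true f =P set0) => [e1|//].
  case/negP: npmf; apply/forallP=> i.
  move/forallP/(_ i)/and3P: pf => [-> /implyP H _]; apply: H.
  apply/eqP=> fi; have : i \in opens k (odd i) f by rewrite inE Dk ltn_ord fi !eqxx.
  by case: (odd i); rewrite ?e0 ?e1 inE.
have lt_kN : (k < N)%N by lia.
pose K := Ordinal lt_kN; rewrite -[k]/(K : nat) in Dd le_kN pf bal *.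
move: K Dd le_kN pf bal => {lt_kN}K Dd le_kN pf bal.
set O := opens K (~~ odd K) f.
have prodE m : \prod_(i : 'I_N | (K <= i)%N) item_wt m i
    = item_wt m K * \prod_(i : 'I_N | (K.+1 <= i)%N) item_wt m i.
  rewrite (bigD1 K) //=; congr (_ * _); apply: eq_bigl => i.
  by rewrite ltn_neqAle eq_sym andbC.
(* Either K opens an arc, a rise, or it closes one, a fall. *)
rewrite (bigID (fun m : {ffun 'I_N -> 'I_N} => K < m K)%N) /=; congr (_ + _).
  transitivity (\sum_(m | perfect m && (prefix K.+1 m == f))
      \prod_(i : 'I_N | (K < i)%N) item_wt m i).
    apply: eq_big => [m|m /andP[_ lt_K]].
      by rewrite -andbA; apply: andb_id2l => pm; rewrite prefixS_open.
    by rewrite prodE /item_wt lt_K mul1r.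
  have nK b : K \notin opens K b f by rewrite inE ltnn.
  rewrite IHd; try by [lia | apply: partialS_open].
    rewrite !opensS_open //; congr (dyck _ _ _).
    by case: (odd K) => /=; rewrite cardsU1 nK add1n ?addSn ?addnS.
  by rewrite !opensS_open // /=; case: (odd K) bal => /= bal;
    rewrite cardsU1 nK bal ?add1n ?addn0 ?addn1.
have -> : \sum_(m | perfect m && (prefix K m == f) && ~~ (K < m K)%N)
     \prod_(i : 'I_N | (K <= i)%N) item_wt m i
  = \sum_(z in O) \sum_(m | perfect m && (prefix K.+1 m == add_arc f K z))
     \prod_(i : 'I_N | (K <= i)%N) item_wt m i.
  rewrite (partition_big (fun m : {ffun 'I_N -> 'I_N} => m K) [in O]) /=.
    apply: eq_bigr => z zO; apply: eq_bigl => m.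
    rewrite -!andbA; apply: andb_id2l => pm; rewrite prefixS_arc //.
    apply: andb_id2l => _; apply: andb_idl => /eqP ->.
    by move: zO; rewrite inE -leqNgt => /andP[/ltnW].
  move=> m /andP[/andP[pm /eqP pfE]]; rewrite -leqNgt => le_mK.
  have /forallP/(_ K)/andP[/eqP mmK oddK] := pm.
  have lt_mK : (m K < K)%N.
    by rewrite ltn_neqAle le_mK andbT (perfect_neq K pm).
  rewrite inE lt_mK -pfE prefix_open // mmK leqnn /=.
  by move: oddK; case: (odd (m K)); case: (odd K).
transitivity (\sum_(z in O) W (odd K) #|[set j in O | (j < z)%N]| #|[set j in O | (z < j)%N]|
   * dyck a d (#|opens K false f| + #|opens K true f|).-1).
  apply: eq_bigr => z zO.
  have -> : dyck a d (#|opens K false f| + #|opens K true f|).-1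
     = \sum_(m | perfect m && (prefix K.+1 m == add_arc f K z))
          \prod_(i : 'I_N | (K.+1 <= i)%N) item_wt m i.
    have oz : odd z = ~~ odd K by move: zO; rewrite inE => /and3P[_ _ /eqP].
    have zin b : (z \in opens K b f) = (b == ~~ odd K).
      by move: zO; rewrite !inE => /and3P[-> -> /eqP ->]; rewrite eq_sym.
    have := cardsD1 z (opens K false f); have := cardsD1 z (opens K true f).
    rewrite !zin; move: bal => bal cT cF.
    rewrite IHd; try by [lia | apply: partialS_arc].
      rewrite !opensS_arc //; congr (dyck _ _ _).
      by move: bal cT cF; case: (odd K) => /=; lia.
    by rewrite !opensS_arc //=; move: bal cT cF; case: (odd K) => /=; lia.
  rewrite mulr_sumr; apply: eq_bigr => m /andP[pm]; rewrite prefixS_arc //.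
  case/andP=> /eqP pfE /eqP mK; rewrite prodE; congr (_ * _).
  rewrite /item_wt mK /avail pfE -/O ifN // -leqNgt.
  by move: zO; rewrite inE => /andP[/ltnW].
rewrite -mulr_suml sum_rank.
have [O0|O_gt0] := posnP #|O|.
  rewrite O0 big_ord0 mul0r; move: O0 bal; rewrite /O.
  by case: (odd K) => /= -> => [|->]; rewrite ?addn1.
rewrite W_sum //.
have -> : (#|opens K false f| + #|opens K true f|)%N = (#|O|.*2 - odd K)%N.
  by rewrite /O bal; case: (odd K) bal => /=; lia.
case Dh: (#|O|.*2 - odd K)%N => [|h //].
by move: Dh O_gt0; case: (odd K); lia.
Qed.

Lemma sum_perfect : \sum_(m | perfect m) \prod_i item_wt m i = dyck a N 0.
Proof.
pose e : {ffun 'I_N -> 'I_N} := [ffun i => i].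
have opens0 b : #|opens 0 b e| = 0%N by apply: eq_card0 => i; rewrite inE.
have := @sum_perfect_prefix 0 e (leq0n _); rewrite !opens0 subn0 => <- //.
  apply: eq_bigl => m; rewrite (_ : prefix 0 m == e) ?andbT //.
by apply/forallP=> i; rewrite !ffunE !eqxx implybT.
Qed.

End Matchings.

(** * Permutations as perfect matchings *)
Section PermMatching.

Variable n : nat.
Implicit Types (s : 'S_n) (i j l : 'I_n) (b : bool) (e : 'I_n.*2).

Fact item_subproof b i : (b + i.*2 < n.*2)%N.
Proof. by case: i b => i lt_in [] /=; lia. Qed.

(** The position i is the point 2i + 1 (b = true) and the value i is the point
    2i (b = false). With the value i just before the position i, a fixed point is
    an arc closed by its position, and a lower join is a crossing. *)
Definition item b i : 'I_n.*2 := Ordinal (item_subproof b i).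

Fact idx_subproof e : (e./2 < n)%N.
Proof. by case: e => e lt_en /=; lia. Qed.

Definition idx e : 'I_n := Ordinal (idx_subproof e).

Lemma odd_item b i : odd (item b i) = b.
Proof. by rewrite /= oddD odd_double addbF; case: b. Qed.

Lemma itemK b : cancel (item b) idx.
Proof. by move=> i; apply: val_inj; rewrite /= half_bit_double. Qed.

Lemma idxK e : item (odd e) (idx e) = e.
Proof. by apply: val_inj; rewrite /= odd_double_half. Qed.

Lemma big_items (R : Type) (idop : R) (op : Monoid.com_law idop) (F : 'I_n.*2 -> R) :
  \big[op/idop]_e F e
  = op (\big[op/idop]_i F (item true i)) (\big[op/idop]_i F (item false i)).
Proof.
have half b : \big[op/idop]_(e : 'I_n.*2 | odd e == b) F e
            = \big[op/idop]_i F (item b i).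
  rewrite (reindex_onto (item b) idx) /=; last by move=> e /eqP <-; apply: idxK.
  by apply: eq_bigl => i; rewrite itemK eqxx andbT -[odd _]/(odd (item b i)) odd_item eqxx.
rewrite (bigID (fun e : 'I_n.*2 => odd e)) /= -!half.
by congr (op _ _); apply: eq_bigl => e; case: (odd e).
Qed.

Lemma card_items b (A : {set 'I_n.*2}) : {in A, forall e, odd e = b} ->
  #|A| = #|[set i | item b i \in A]|.
Proof.
move=> oddA; rewrite -[RHS](card_imset _ (can_inj (itemK b))).
apply: eq_card => e; apply/idP/imsetP=> [eA|[i]]; last by rewrite inE => iA ->.
by exists (idx e); rewrite ?inE -(oddA e eA) idxK.
Qed.

(** The arc of the position i is closed by its value when i is an excedance and
    by i itself otherwise. *)
Definition matching s : {ffun 'I_n.*2 -> 'I_n.*2} :=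
  [ffun e : 'I_n.*2 => if odd e then item false (s (idx e)) else item true ((s^-1)%g (idx e))].

Lemma matching_pos s i : matching s (item true i) = item false (s i).
Proof. by rewrite ffunE odd_item itemK. Qed.

Lemma matching_val s i : matching s (item false i) = item true ((s^-1)%g i).
Proof. by rewrite ffunE odd_item itemK. Qed.

Lemma perfect_matching s : perfect (matching s).
Proof.
apply/forallP=> e; rewrite -[e]idxK; case: (odd e).
  by rewrite matching_pos matching_val permK !odd_item eqxx.
by rewrite matching_val matching_pos permKV !odd_item eqxx.
Qed.

Lemma matching_inj : injective matching.
Proof.
move=> s t eq_st; apply/permP=> i; apply: (can_inj (itemK false)).
by rewrite -!matching_pos eq_st.
Qed.

Lemma matching_onto m : perfect m -> exists s, matching s = m.
Proof.
move=> pm; have mK e : m (m e) = e by have /forallP/(_ e)/andP[/eqP] := pm.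
have mE b i : m (item b i) = item (~~ b) (idx (m (item b i))).
  rewrite -[LHS]idxK; congr item.
  have /forallP/(_ (item b i))/andP[_] := pm; rewrite odd_item.
  by case: (odd _); case: b.
have s_inj : injective (fun i => idx (m (item true i))).
  move=> i j eq_ij; apply: (can_inj (itemK true)).
  by rewrite -[LHS]mK -[RHS]mK [m (item true i)]mE eq_ij -mE.
have m_pos i : m (item true i) = item false (perm s_inj i) by rewrite permE; apply: (mE true).
exists (perm s_inj); apply/ffunP=> e; rewrite -[e]idxK; case: (odd e).
  by rewrite matching_pos m_pos.
by rewrite matching_val; apply: (can_inj mK); rewrite mK m_pos permKV.
Qed.

Lemma sum_perfect_matching (R : nmodType) (F : {ffun 'I_n.*2 -> 'I_n.*2} -> R) :
  \sum_(m | perfect m) F m = \sum_s F (matching s).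
Proof.
rewrite (eq_bigl [in matching @: setT]) => [|m].
  rewrite big_imset /=; last by move=> s t _ _; apply: matching_inj.
  by apply: eq_bigl => s; rewrite inE.
apply/idP/imsetP=> [/matching_onto[s <-]|[s _ ->]]; first by exists s; rewrite ?inE.
exact: perfect_matching.
Qed.

Definition left_inv s i := #|[set j : 'I_n | (j < i)%N && (s i < s j)%N]|.
Definition right_inv s i := #|[set j : 'I_n | (i < j)%N && (s j < s i)%N]|.
Definition upper_cross s i :=
  #|[set j : 'I_n | [&& i < j, j < s i & s i < s j]%N]|.

(** The bound s j <= i is weak: s j < i is a lower crossing, s j = i a lower
    join. *)
Definition lower_cross s i :=
  #|[set j : 'I_n | [&& i < j, s i < s j & s j <= i]%N]|.

Lemma card_ord_lt k : (k <= n)%N -> #|[set j : 'I_n | (j < k)%N]| = k.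
Proof. by move=> le_kn; rewrite -sum1dep_card (big_ord_narrow le_kn) sum1_card card_ord. Qed.

(** The points (j, s j) strictly below and to the left of (i, s i) complete the
    left inversions to i and the right inversions to s i. Hence antirecords are
    not excedances, records that are not antirecords are excedances, and both
    counts agree at a fixed point. *)
Lemma left_right_inv s i : (left_inv s i + s i = right_inv s i + i)%N.
Proof.
pose B := #|[set j : 'I_n | (j < i)%N && (s j < s i)%N]|.
have i_split : (i = left_inv s i + B :> nat)%N.
  rewrite -[LHS](card_ord_lt (ltnW (ltn_ord i))).
  rewrite -[LHS](cardsID [set j | (s i < s j)%N]); congr (_ + _)%N.
    by apply: eq_card => j; rewrite !inE.
  apply: eq_card => j; rewrite !inE; have [->|neq_ij] := eqVneq j i; first by lia.
  have : s j != s i by rewrite (inj_eq perm_inj).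
  by rewrite -val_eqE /=; lia.
suffices si_split : (s i = right_inv s i + B :> nat)%N by lia.
rewrite -[LHS](card_ord_lt (ltnW (ltn_ord (s i)))).
rewrite -(card_preimset _ (@perm_inj _ s)).
rewrite -[LHS](cardsID [set j : 'I_n | (i < j)%N]); congr (_ + _)%N.
  by apply: eq_card => j; rewrite !inE andbC.
apply: eq_card => j; rewrite !inE; have [->|neq_ij] := eqVneq j i; first by lia.
by move: neq_ij; rewrite -val_eqE /=; lia.
Qed.

Section Weights.

Variables (R : comNzRingType) (W : bool -> nat -> nat -> R).

Lemma mem_avail s (K : 'I_n.*2) e :
  (e \in avail (matching s) K) = [&& (e < K)%N, (K <= matching s e)%N & odd e == ~~ odd K].
Proof.
rewrite inE; apply: andb_id2l => lt_eK.
by rewrite prefix_open ?perfect_matching.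
Qed.

Lemma card_avail_val s v (P : pred 'I_n.*2) :
  #|[set e in avail (matching s) (item false v) | P e]|
  = #|[set j : 'I_n | [&& j < v, v <= s j & P (item true j)]%N]|.
Proof.
rewrite (@card_items true) => [|e]; last first.
  by rewrite inE mem_avail odd_item => /andP[/and3P[_ _ /eqP]].
apply: eq_card => j; rewrite inE [LHS]inE mem_avail matching_pos !odd_item inE.
by rewrite andbT -andbA; congr [&& _, _ & _]; rewrite /=; lia.
Qed.

Lemma card_avail_pos s i (P : pred 'I_n.*2) :
  #|[set e in avail (matching s) (item true i) | P e]|
  = #|[set l : 'I_n | [&& s l <= i, i <= l & P (item false (s l))]%N]|.
Proof.
rewrite (@card_items false) => [|e]; last first.
  by rewrite inE mem_avail odd_item => /andP[/and3P[_ _ /eqP]].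
rewrite -(card_preimset _ (@perm_inj _ s)); apply: eq_card => l.
rewrite inE inE [LHS]inE mem_avail matching_val permK !odd_item inE.
by rewrite andbT -andbA; congr [&& _, _ & _]; rewrite /=; lia.
Qed.

Lemma eq_image s i j : (s j == s i :> nat) = (j == i :> nat).
Proof. by rewrite !(inj_eq val_inj) (inj_eq perm_inj). Qed.

(** At a closing value, available positions to the left of the partner i are left
    inversions of i, those to its right the upper crossings. *)
Lemma item_wt_val s i : item_wt W (matching s) (item false (s i))
  = if (i < s i)%N then W false (left_inv s i) (upper_cross s i) else 1.
Proof.
rewrite /item_wt matching_val permK odd_item /=.
have -> : (false + (s i).*2 < true + i.*2)%N = ~~ (i < s i)%N by lia.
rewrite if_neg; case: ifP => // lt_i; rewrite !card_avail_val.
by congr (W _ _ _); apply: eq_card => j; rewrite !inE /=;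
  have := eq_image s i j; lia.
Qed.

(** At a closing position i, available values below s i are right inversions of
    i, those above it the lower crossings and the lower join. *)
Lemma item_wt_pos s i : item_wt W (matching s) (item true i)
  = if (s i <= i)%N then W true (right_inv s i) (lower_cross s i) else 1.
Proof.
rewrite /item_wt matching_pos odd_item /=.
have -> : (true + i.*2 < false + (s i).*2)%N = ~~ (s i <= i)%N by lia.
rewrite if_neg; case: ifP => // le_i; rewrite !card_avail_pos.
by congr (W _ _ _); apply: eq_card => j; rewrite !inE /=;
  have := eq_image s i j; lia.
Qed.

End Weights.
End PermMatching.

(** * The statistics as sums of local contributions *)
Section StatisticSums.

Variable n : nat.
Implicit Types (s : 'S_n) (i j l : 'I_n).

(** A pattern is determined by two of its indices, which f completes. *)
Lemma card_pairs (T : finType) (A : {set T}) (f : 'I_n -> 'I_n -> T) :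
  (forall i j i' j', f i j = f i' j' -> (i, j) = (i', j')) ->
  (forall t, t \in A -> exists i j, t = f i j) ->
  #|A| = (\sum_i #|[set j | f i j \in A]|)%N.
Proof.
move=> f_inj f_onto; pose F p := f p.1 p.2.
have F_inj : injective F by move=> [i j] [i' j'] /f_inj.
rewrite (_ : A = F @: [set p | F p \in A]).
  rewrite card_imset // -sum1dep_card.
  rewrite -(pair_big_dep xpredT (fun i j => f i j \in A) (fun _ _ => 1%N)) /=.
  apply: eq_bigr => i _; rewrite sum1dep_card; apply: eq_card => j.
  by rewrite !inE -[f i j]/(F (i, j)) mem_imset // inE.
apply/setP=> t; apply/idP/imsetP=> [tA|[p]]; last by rewrite inE => pA ->.
have [i [j tE]] := f_onto t tA.
by exists (i, j); rewrite ?inE /F /= -?tE.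
Qed.

Lemma ucross_sum s : ucross s = (\sum_(i : 'I_n | (i < s i)%N) upper_cross s i)%N.
Proof.
rewrite /ucross (@card_pairs _ _ (fun i j => (i, j, s i, s j))) => [| | [[[i j] k] l]].
- rewrite [RHS]big_mkcond; apply: eq_bigr => i _; case: ifP => lt_i.
    by apply: eq_card => j; rewrite !inE !eqxx !andbT.
  by apply: eq_card0 => j; rewrite !inE; lia.
- by move=> i j i' j' [-> ->].
- rewrite inE => /and5P[_ _ _ /eqP -> /eqP ->]; by exists i, j.
Qed.

(** Each nesting is counted at its inner arc, for which the outer arc starts at
    a left inversion. *)
Lemma unest_sum s : unest s = (\sum_(i : 'I_n | (i < s i)%N) left_inv s i)%N.
Proof.
rewrite /unest (@card_pairs _ _ (fun j i => (i, j, s j, s i))) => [| | [[[i j] k] l]].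
- rewrite [RHS]big_mkcond; apply: eq_bigr => j _; case: ifP => lt_j.
    by apply: eq_card => i; rewrite !inE !eqxx !andbT; lia.
  by apply: eq_card0 => i; rewrite !inE; lia.
- by move=> i j i' j' [-> ->].
- rewrite inE => /and5P[_ _ _ /eqP -> /eqP ->]; by exists j, i.
Qed.

Lemma lcross_ljoin_sum s :
  (lcross s + ljoin s = \sum_(i : 'I_n | (s i <= i)%N) lower_cross s i)%N.
Proof.
rewrite /lcross (@card_pairs _ _ (fun k l => (s k, s l, k, l))) => [| | [[[i j] k] l]].
- rewrite /ljoin (@card_pairs _ _ (fun j l => (s j, j, l))) => [| | [[i j] l]].
  + rewrite [RHS]big_mkcond -big_split /=; apply: eq_bigr => k _.
    case: ifP => lt_k; last first.
      by rewrite !eq_card0 // => l; rewrite !inE; lia.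
    rewrite /lower_cross -[RHS](cardsID [set l : 'I_n | (s l < k)%N]).
    by congr (_ + _)%N; apply: eq_card => l; rewrite !inE ?eqxx -?val_eqE /=; lia.
  + by move=> i j i' j' [_ -> ->].
  + rewrite inE => /and4P[_ _ /eqP -> /eqP jE]; by exists j, l.
- by move=> i j i' j' [_ _ -> ->].
- rewrite inE => /and5P[_ _ _ /eqP -> /eqP ->]; by exists k, l.
Qed.

(** The right inversions of i are lower nestings if s i < i. At a fixed point
    they are as numerous as the left inversions, which are the pseudo-nestings. *)
Lemma lnest_psnest_sum s :
  (lnest s + psnest s = \sum_(i : 'I_n | (s i <= i)%N) right_inv s i)%N.
Proof.
rewrite /lnest (@card_pairs _ _ (fun k l => (s l, s k, k, l))) => [| | [[[i j] k] l]].
- rewrite /psnest (@card_pairs _ _ (fun j i => (i, j, s i))) => [| | [[i j] l]].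
  + rewrite [RHS]big_mkcond -big_split /=; apply: eq_bigr => k _.
    case: (ltngtP (s k) k) => [lt_k|gt_k|eq_k].
    * rewrite [X in (_ + X)%N]eq_card0 ?addn0; last first.
        by move=> i; rewrite !inE -val_eqE /=; lia.
      by apply: eq_card => l; rewrite !inE !eqxx; lia.
    * by rewrite !eq_card0 // => l; rewrite !inE -?val_eqE /=; lia.
    * rewrite [X in (X + _)%N]eq_card0 ?add0n; last first.
        by move=> i; rewrite !inE; lia.
      have := left_right_inv s k; rewrite eq_k => /addIn <-.
      by apply: eq_card => i; rewrite !inE !eqxx -val_eqE /=; lia.
  + by move=> i j i' j' [-> -> _].
  + rewrite inE => /and4P[_ _ _ /eqP ->]; by exists j, i.
- by move=> i j i' j' [_ _ -> ->].
- rewrite inE => /and5P[_ _ _ /eqP -> /eqP ->]; by exists k, l.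
Qed.

Lemma left_inv0 s i : (left_inv s i == 0%N) = is_record s i.
Proof.
rewrite cards_eq0; apply/eqP/forallP=> [inv0 j|rec_i].
  apply/implyP=> lt_ji; have := eq_image s i j.
  by have := in_set0 j; rewrite -inv0 inE; lia.
by apply/setP=> j; rewrite !inE; have := rec_i j; lia.
Qed.

Lemma right_inv0 s i : (right_inv s i == 0%N) = is_antirecord s i.
Proof.
rewrite cards_eq0; apply/eqP/forallP=> [inv0 j|rec_i].
  apply/implyP=> lt_ji; have := eq_image s i j.
  by have := in_set0 j; rewrite -inv0 inE; lia.
by apply/setP=> j; rewrite !inE; have := rec_i j; lia.
Qed.

Lemma arec_card s : arec s = #|[set i : 'I_n | (s i <= i)%N && (right_inv s i == 0%N)]|.
Proof.
apply: eq_card => i; rewrite !inE -right_inv0.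
by have := left_right_inv s i; lia.
Qed.

Lemma erec_card s : erec s = #|[set i : 'I_n | (i < s i)%N && (left_inv s i == 0%N)]|.
Proof.
apply: eq_card => i; rewrite !inE -right_inv0 -left_inv0.
by have := left_right_inv s i; lia.
Qed.

Lemma exc_erec_card s :
  (exc s - erec s)%N = #|[set i : 'I_n | (i < s i)%N && (left_inv s i != 0%N)]|.
Proof.
rewrite erec_card /exc -(cardsID [set i | left_inv s i == 0%N]).
rewrite (_ : #|_ :&: _| = #|[set i : 'I_n | (i < s i)%N && (left_inv s i == 0%N)]|).
  by rewrite addKn; apply: eq_card => i; rewrite !inE andbC.
by apply: eq_card => i; rewrite !inE.
Qed.

Lemma nexc_arec_card s :
  (n - exc s - arec s)%N = #|[set i : 'I_n | (s i <= i)%N && (right_inv s i != 0%N)]|.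
Proof.
rewrite arec_card /exc -subnDA -[X in (X - _)%N]card_ord.
rewrite -[X in (X - _)%N]cardsT -(cardsID [set i : 'I_n | (i < s i)%N]) setTI subnDl.
rewrite -(cardsID [set i | right_inv s i == 0%N] (setT :\: _)).
rewrite (_ : #|_ :&: _| = #|[set i : 'I_n | (s i <= i)%N && (right_inv s i == 0%N)]|).
  by rewrite addKn; apply: eq_card => i; rewrite !inE andbT -leqNgt andbC.
by apply: eq_card => i; rewrite !inE andbT -leqNgt.
Qed.

End StatisticSums.

(** * Weights of the arcs *)

(** The weight of an arc nested in r arcs and crossing c arcs when it closes;
    r = 0 is the case of an antirecord or of an exclusive record. *)
Definition arc_wt (R : comNzRingType) (x u p q : R) (r c : nat) : R :=
  (if r == 0%N then x else q ^+ r * u) * p ^+ c.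

Lemma sum_arc_wt (R : comNzRingType) (x u p q : R) c :
  \sum_(r < c.+1) arc_wt x u p q r (c - r) = p ^+ c * x + q * pq_int p q c * u.
Proof.
rewrite big_ord_recl /arc_wt /= subn0 mulrC; congr (_ + _).
rewrite /pq_int mulr_sumr mulr_suml (reindex_inj rev_ord_inj) /=.
apply: eq_bigr => i _; rewrite /bump /= add1n exprS.
have -> : (c - (c - i.+1).+1 = i)%N by case: i => i /=; lia.
have -> : (c - 1 - i = c - i.+1)%N by lia.
by rewrite -!mulrA; congr (_ * _); rewrite [RHS]mulrC mulrA.
Qed.

Theorem theorem2p8 (R : comNzRingType) (x y u v pp pm qp qm : R)
    (alpha : nat -> R)
    (alpha_odd : forall k : nat, (1 <= k)%N ->
      alpha (2 * k - 1)%N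
      = pm ^+ (k - 1) * x + qm * pq_int pm qm (k - 1) * u)
    (alpha_even : forall k : nat, (1 <= k)%N ->
      alpha (2 * k)%N
      = pp ^+ (k - 1) * y + qp * pq_int pp qp (k - 1) * v) :
  is_sfrac alpha (Ppoly x y u v pp pm qp qm).
Proof.
pose W (b : bool) := if b then arc_wt x u pm qm else arc_wt y v pp qp.
have W_sum b c : (0 < c)%N -> \sum_(r < c) W b r (c - 1 - r)%N = alpha (c.*2 - b)%N.
  case: c => // c _; rewrite subn1 -mul2n.
  by case: b; rewrite /W sum_arc_wt [RHS]/= ?subn0 (alpha_odd, alpha_even) // subn1.
apply: is_sfrac_dyck => n; rewrite -(sum_perfect _ W_sum) sum_perfect_matching.
apply: eq_bigr => s _; rewrite big_items.
(* Listing the values as s i brings the two ends of each arc together. *)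
have -> : \prod_i item_wt W (matching s) (item false i)
        = \prod_i item_wt W (matching s) (item false (s i)).
  by rewrite (reindex_inj (@perm_inj _ s)).
rewrite (eq_bigr _ (fun i _ => item_wt_pos W s i)).
rewrite [X in _ = _ * X](eq_bigr _ (fun i _ => item_wt_val W s i)).
rewrite exc_erec_card nexc_arec_card arec_card erec_card ucross_sum unest_sum.
rewrite lcross_ljoin_sum lnest_psnest_sum.
have exp_card (z : R) (P : pred 'I_n) :
    z ^+ #|[set i | P i]| = \prod_i (if P i then z else 1).
  by rewrite -big_mkcond prodr_const cardsE.
have exp_sum (z : R) (P : pred 'I_n) (F : 'I_n -> nat) :
    z ^+ (\sum_(i | P i) F i)%N = \prod_i (if P i then z ^+ F i else 1).
  by rewrite -big_mkcond prodrXr.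
rewrite !exp_card !exp_sum -!big_split /=; apply: eq_bigr => i _.
rewrite leqNgt; case: (i < s i)%N => /=; rewrite /arc_wt.
  by case: eqP => [->|_] /=; rewrite ?expr0 ?mulr1 ?mul1r // mulrAC [_ * v]mulrC.
by case: eqP => [->|_] /=; rewrite ?expr0 ?mulr1 ?mul1r // mulrAC [_ * u]mulrC.
Qed.
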